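(* Let $G=(V,E)$ be a finite directed graph with edge weights $w:E\to\mathbb{R}$ and source $s\in V$. Consider a frontier-based relaxation process producing distance vectors $d^{(t)}:V\to\mathbb{R}\cup\{+\infty\}$ and frontiers $F^{(t)}\subseteq V$ for $t=0,1,2,\dots$, as follows. Initially $d^{(0)}(s)=0$, $d^{(0)}(v)=+\infty$ for $v\neq s$, and $F^{(0)}=\{s\}$. For each $t\ge 1$, outer iteration $t$ starts from the vector $d^{(t-1)}$ and performs a finite sequence of relaxation operations, each of the form $d(y)\leftarrow\min\{d(y),\,d(x)+w(x,y)\}$ for some edge $(x,y)\in E$ (evaluated with the current values), where every relaxation performed in iteration $t$ is on an edge whose tail lies in $F^{(t-1)}$ (these may include additional multi-hop ''jump propagation'' relaxations), and every edge whose tail lies in $F^{(t-1)}$ is relaxed at least once during iteration $t$. Let $d^{(t)}$ be the vector at the end of iteration $t$ and $F^{(t)}=\{v\in V: d^{(t)}(v)<d^{(t-1)}(v)\}$. If $G$ has no negative-weight cycle reachable from $s$, then \[ d^{(|V|-1)}(v)=d^\ast(v)\quad\text{for all } v\in V. \] Moreover, if there exist $v\in V$ and $t\ge |V|$ with $d^{(t)}(v)<d^{(|V|-1)}(v)$ (a strict improvement after $|V|-1$ iterations), then $G$ contains a negative-weight cycle reachable from $s$.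
   Context: A directed $s\to v$ path is a sequence of edges $(x_0,x_1),\dots,(x_{\ell-1},x_\ell)\in E$ with $x_0=s$, $x_\ell=v$ (vertices need not be distinct); its length is the sum of its edge weights, and the path with $0$ edges from $s$ to $s$ has length $0$. $d^\ast(v)$ denotes the true shortest-path distance from $s$ to $v$, i.e. the infimum of the lengths of all directed $s\to v$ paths ($+\infty$ if no such path exists). A negative-weight cycle reachable from $s$ is a directed cycle of negative total weight containing a vertex reachable from $s$. Convention: $+\infty+a=+\infty$. *)

(* Defs.v *)
From mathcomp Require Export all_boot all_order all_algebra.
From mathcomp Require Export classical_sets reals constructive_ereal ereal.

Set Implicit Arguments.
Unset Strict Implicit.
Unset Printing Implicit Defensive.

Import Order.TTheory GRing.Theory Num.Theory.

Local Open Scope classical_set_scope.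
Local Open Scope ring_scope.
Local Open Scope ereal_scope.

(* A directed graph is E : rel V on a finType V (loops allowed).  The weight
   function is total, but only its values on pairs (x, y) with E x y are ever
   used.  A path x_0, x_1, ..., x_l is given, as in path.v, by its source x_0 and
   the sequence [:: x_1; ...; x_l]. *)

Definition path_length (R : realType) (V : finType) (w : V -> V -> R)
    (x : V) (p : seq V) : R :=
  (\sum_(a <- pairmap w x p) a)%R.

Definition distance (R : realType) (V : finType) (E : rel V) (w : V -> V -> R)
    (s v : V) : \bar R :=
  ereal_inf [set (path_length w s p)%:E | p in [set p | path E s p /\ last s p = v]].

Definition cycle_length (R : realType) (V : finType) (w : V -> V -> R)
    (c : seq V) : R :=
  if c is x :: p then path_length w x (rcons p x) else 0%R.

(* Cycles have no repeated vertex (ucycle); a loop is a cycle.  The empty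
   sequence is excluded since it has length 0. *)
Definition reachable_negative_cycle (R : realType) (V : finType) (E : rel V)
    (w : V -> V -> R) (s : V) : Prop :=
  exists c : seq V,
    [/\ ucycle E c, (cycle_length w c < 0)%R
      & exists2 x, x \in c & connect E s x].

Definition relax (R : realType) (V : finType) (w : V -> V -> R)
    (d : V -> \bar R) (e : V * V) : V -> \bar R :=
  fun v => if v == e.2 then Order.min (d e.2) (d e.1 + (w e.1 e.2)%:E) else d v.

Definition relax_iteration (R : realType) (V : finType) (E : rel V)
    (w : V -> V -> R) (F : {set V}) (d d' : V -> \bar R) : Prop :=
  exists r : seq (V * V),
    [/\ forall e, e \in r -> E e.1 e.2 /\ e.1 \in F,
        forall x y, x \in F -> E x y -> (x, y) \in r
      & d' =1 foldl (relax w) d r].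

(* Distance vectors take values in \bar R; the value -oo never occurs, as it is
   neither an initial value nor produced by a relaxation. *)
Definition frontier_process (R : realType) (V : finType) (E : rel V)
    (w : V -> V -> R) (s : V) (d : nat -> V -> \bar R) (F : nat -> {set V})
    : Prop :=
  [/\ forall v, d 0%N v = if v == s then 0 else +oo,
      F 0%N = [set s]%SET,
      forall t, relax_iteration E w (F t) (d t) (d t.+1)
    & forall t, F t.+1 = [set v | d t.+1 v < d t v]%SET].

(* Main.v *)
Require Import Defs.
From mathcomp Require Import boolp.

Set Implicit Arguments.
Unset Strict Implicit.
Unset Printing Implicit Defensive.

Import Order.TTheory GRing.Theory Num.Theory.

Local Open Scope ereal_scope.

(** Working from the frontier alone loses nothing: for [t > 0], a vertex
    outside [F t] has kept its value during iteration [t], and its outgoing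
    edges were relaxed in that iteration or, inductively, needed no
    relaxation. So every iteration in effect relaxes all edges and, as in
    Bellman-Ford, [d t v] is at most the length of every path from [s] to [v]
    with at most [t] edges. In the other direction, relaxation preserves every
    lower bound [h] satisfying [h y <= h x + w x y] along the edges, and by
    the triangle inequality the distance from [s] is such a bound. Without
    reachable negative cycles, cutting closed subpaths out does not increase
    the length, so that the distance is an infimum over paths without repeated
    vertices. These have at most [#|V| - 1] edges, hence [d t] is the distance
    for all [t >= #|V| - 1]. *)

Section Paths.
Variables (R : realType) (V : finType) (E : rel V) (w : V -> V -> R).
Implicit Types (s x y v : V) (p q : seq V) (h : V -> \bar R).

Lemma path_length_nil x : path_length w x [::] = 0%R.
Proof. exact: big_nil. Qed.

Lemma path_length_cons x y p :
  path_length w x (y :: p) = (w x y + path_length w y p)%R.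
Proof. exact: big_cons. Qed.

Lemma path_length_cat x p q :
  path_length w x (p ++ q) = (path_length w x p + path_length w (last x p) q)%R.
Proof. by rewrite /path_length pairmap_cat big_cat. Qed.

Lemma path_length_rcons x p y :
  path_length w x (rcons p y) = (path_length w x p + w (last x p) y)%R.
Proof.
by rewrite -cats1 path_length_cat path_length_cons path_length_nil addr0.
Qed.

Lemma distance_le_path_length s p : path E s p ->
  distance E w s (last s p) <= (path_length w s p)%:E.
Proof. by move=> Ep; apply: ereal_inf_lbound; exists p. Qed.

Lemma distance_source_le0 s : distance E w s s <= 0.
Proof.
by have := @distance_le_path_length s [::] isT; rewrite path_length_nil.
Qed.

Definition feasible_potential h : Prop :=
  forall x y, E x y -> h y <= h x + (w x y)%:E.

Lemma distance_feasible s : feasible_potential (distance E w s).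
Proof.
move=> x y Exy; rewrite -leeBlDr//.
apply: le_ereal_inf_tmp => _ [p [Ep last_p] <-]; rewrite leeBlDr//.
have Epy : path E s (rcons p y) by rewrite rcons_path Ep last_p.
have := distance_le_path_length Epy.
by rewrite last_rcons path_length_rcons last_p EFinD.
Qed.

Lemma path_le_of_edge_le (d : nat -> V -> \bar R) :
  (forall t x y, E x y -> d t.+1 y <= d t x + (w x y)%:E) ->
  forall t x p, path E x p ->
    d (t + size p)%N (last x p) <= d t x + (path_length w x p)%:E.
Proof.
move=> d_edge t x p; elim: p t x => [|y p IHp] t x /=.
  by rewrite addn0 path_length_nil adde0.
case/andP=> Exy Ep; rewrite addnS -addSn path_length_cons EFinD addeA.
by apply: (le_trans (IHp _ _ Ep)); apply: leeD2r; apply: d_edge.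
Qed.

End Paths.

Section NoNegativeCycle.
Variables (R : realType) (V : finType) (E : rel V) (w : V -> V -> R) (s : V).
Hypothesis no_negative_cycle : ~ reachable_negative_cycle E w s.
Implicit Types (x v : V) (p q c : seq V).

Lemma reachable_cycle_length_ge0 x c :
  ucycle E c -> x \in c -> connect E s x -> (0 <= cycle_length w c)%R.
Proof.
move=> Ec cx sx; rewrite leNgt; apply/negP => c_lt0.
by apply: no_negative_cycle; exists c; split=> //; exists x.
Qed.

(* If the simple path found from the second vertex on passes through [x] again,
   its part after [x] is shorter than the path by a nonnegative cycle. *)
Lemma simple_path_le x p : connect E s x -> path E x p ->
  exists q, [/\ path E x q, last x q = last x p, uniq (x :: q)
    & (path_length w x q <= path_length w x p)%R].
Proof.
elim: p x => [|y p IHp] x sx; first by exists [::].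
case/andP=> Exy Ep.
have [q [Eq last_q uniq_q le_qp]] := IHp _ (connect_trans sx (connect1 Exy)) Ep.
have Eyq : path E x (y :: q) by rewrite /= Exy.
have last_yq : last x (y :: q) = last x (y :: p) by [].
have {le_qp} : (path_length w x (y :: q) <= path_length w x (y :: p))%R.
  by rewrite !path_length_cons lerD2l.
have [xyq|xNyq] := boolP (x \in y :: q); last first.
  by exists (y :: q); split=> //; rewrite cons_uniq xNyq.
case/splitPr: xyq uniq_q Eyq last_yq => q1 q2.
rewrite -cat_rcons cat_path last_cat last_rcons path_length_cat last_rcons.
rewrite cat_uniq rcons_uniq => /and3P[uniq_q1 xNq2 uniq_q2] /andP[Eq1 Eq2] <-.
have cycle_ge0 : (0 <= cycle_length w (x :: q1))%R.
  by apply: (@reachable_cycle_length_ge0 x); rewrite ?mem_head// /ucycle /= Eq1.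
move=> le_qp; exists q2; split=> //.
  rewrite cons_uniq uniq_q2 andbT; apply: contra xNq2 => q2x.
  by apply/hasP; exists x; rewrite // mem_rcons mem_head.
by apply: le_trans le_qp; rewrite lerDr.
Qed.

Lemma le_distance_of_simple_paths (a : \bar R) v :
  (forall p, path E s p -> last s p = v -> uniq (s :: p) ->
     a <= (path_length w s p)%:E) ->
  a <= distance E w s v.
Proof.
move=> le_a; apply: le_ereal_inf_tmp => _ [p [Ep last_p] <-].
have [q [Eq last_q uniq_q le_qp]] := simple_path_le (connect0 E s) Ep.
apply: (@le_trans _ _ (path_length w s q)%:E); last by rewrite lee_fin.
by apply: le_a => //; rewrite last_q.
Qed.

End NoNegativeCycle.

Section Relaxation.
Variables (R : realType) (V : finType) (E : rel V) (w : V -> V -> R).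
Implicit Types (x y v : V) (d h : V -> \bar R) (r : seq (V * V)) (F : {set V}).

Lemma relax_le d e v : relax w d e v <= d v.
Proof. by rewrite /relax; case: eqP => // ->; rewrite ge_min lexx. Qed.

Lemma relax_edge_le d x y : relax w d (x, y) y <= d x + (w x y)%:E.
Proof. by rewrite /relax eqxx ge_min lexx orbT. Qed.

Lemma relax_ge h d e : feasible_potential E w h -> E e.1 e.2 ->
  (forall v, h v <= d v) -> forall v, h v <= relax w d e v.
Proof.
move=> feas_h Ee le_hd v; rewrite /relax; case: eqP => [->|_] //.
by rewrite le_min le_hd (le_trans (feas_h _ _ Ee))// leeD2r.
Qed.

Lemma foldl_relax_le d r v : foldl (relax w) d r v <= d v.
Proof.
by elim: r d => [//|e r IHr] d /=; apply: le_trans (relax_le _ e _).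
Qed.

Lemma foldl_relax_edge_le d r x y : (x, y) \in r ->
  foldl (relax w) d r y <= d x + (w x y)%:E.
Proof.
elim: r d => [//|e r IHr] d; rewrite inE => /predU1P[<-|/IHr le_r] /=.
  exact: le_trans (foldl_relax_le _ _ _) (relax_edge_le _ _ _).
by apply: (le_trans (le_r _)); apply: leeD2r; apply: relax_le.
Qed.

Lemma foldl_relax_ge h d r : feasible_potential E w h ->
  (forall e, e \in r -> E e.1 e.2) ->
  (forall v, h v <= d v) -> forall v, h v <= foldl (relax w) d r v.
Proof.
move=> feas_h; elim: r d => [//|e r IHr] d Er le_hd /=; apply: IHr => [f fr|].
  by apply: Er; rewrite inE fr orbT.
by apply: relax_ge => //; apply: Er; rewrite mem_head.
Qed.

Lemma relax_iteration_le F d d' v : relax_iteration E w F d d' -> d' v <= d v.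
Proof. by case=> r [_ _ ->]; apply: foldl_relax_le. Qed.

Lemma relax_iteration_edge_le F d d' x y : relax_iteration E w F d d' ->
  x \in F -> E x y -> d' y <= d x + (w x y)%:E.
Proof. by case=> r [_ Fr ->] Fx Exy; apply/foldl_relax_edge_le/Fr. Qed.

Lemma relax_iteration_ge h F d d' : feasible_potential E w h ->
  relax_iteration E w F d d' ->
  (forall v, h v <= d v) -> forall v, h v <= d' v.
Proof.
move=> feas_h [r [Er _ def_d']] le_hd v; rewrite def_d'.
by apply: foldl_relax_ge => // e /Er[].
Qed.

End Relaxation.

Section FrontierProcess.
Variables (R : realType) (V : finType) (E : rel V) (w : V -> V -> R) (s : V).
Variables (d : nat -> V -> \bar R) (F : nat -> {set V}).
Hypothesis proc : frontier_process E w s d F.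
Implicit Types (x y v : V) (p : seq V) (t : nat).

Lemma process_nonincreasing t v : d t.+1 v <= d t v.
Proof. by have [_ _ step _] := proc; apply: relax_iteration_le (step t). Qed.

Lemma process_source_le0 t : d t s <= 0.
Proof.
elim: t => [|t IHt]; first by have [-> _ _ _] := proc; rewrite eqxx.
exact: le_trans (process_nonincreasing _ _) IHt.
Qed.

Lemma process_ge_feasible h : feasible_potential E w h -> h s <= 0 ->
  forall t v, h v <= d t v.
Proof.
have [d0 _ step _] := proc => feas_h hs_le0; elim=> [|t IHt] v.
  by rewrite d0; case: eqP => [->|_]; rewrite ?leey.
exact: relax_iteration_ge feas_h (step t) IHt v.
Qed.

Lemma distance_le_process t v : distance E w s v <= d t v.
Proof.
apply: process_ge_feasible; first exact: distance_feasible.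
exact: distance_source_le0.
Qed.

Lemma process_frontier_edge_le t x y : x \in F t -> E x y ->
  d t.+1 y <= d t x + (w x y)%:E.
Proof.
by have [_ _ step _] := proc; apply: relax_iteration_edge_le (step t).
Qed.

Lemma process_nonfrontier_edge_le t x y : x \notin F t -> E x y ->
  d t y <= d t x + (w x y)%:E.
Proof.
have [d0 F0 _ FS] := proc.
move=> + Exy; elim: t => [|t IHt].
  by rewrite F0 inE (d0 x) => /negPf ->; rewrite addye ?leey.
rewrite FS inE -leNgt => d_ge.
have -> : d t.+1 x = d t x.
  by apply/le_anti; rewrite d_ge process_nonincreasing.
have [Fx|nFx] := boolP (x \in F t); first exact: process_frontier_edge_le.
exact: le_trans (process_nonincreasing _ _) (IHt nFx).
Qed.

Lemma process_edge_le t x y : E x y -> d t.+1 y <= d t x + (w x y)%:E.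
Proof.
move=> Exy; have [Fx|nFx] := boolP (x \in F t).
  exact: process_frontier_edge_le.
apply: le_trans (process_nonincreasing _ _) _.
exact: process_nonfrontier_edge_le.
Qed.

Lemma process_le_path_length t p : path E s p -> (size p <= t)%N ->
  d t (last s p) <= (path_length w s p)%:E.
Proof.
move=> Ep le_pt; rewrite -{1}(subnK le_pt).
apply: (le_trans (path_le_of_edge_le process_edge_le _ Ep)).
by rewrite geeDr// process_source_le0.
Qed.

Lemma process_eq_distance t v : ~ reachable_negative_cycle E w s ->
  (#|V| <= t.+1)%N -> d t v = distance E w s v.
Proof.
move=> no_negative_cycle le_Vt.
apply/le_anti; rewrite distance_le_process andbT.
apply: le_distance_of_simple_paths => // p Ep <- uniq_p.
have size_p : (size (s :: p) <= #|V|)%N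
  by rewrite -(card_uniqP uniq_p) max_card.
by apply: process_le_path_length => //; apply: leq_trans size_p le_Vt.
Qed.

End FrontierProcess.

Theorem theorem2p3 (R : realType) (V : finType) (E : rel V) (w : V -> V -> R)
    (s : V) (d : nat -> V -> \bar R) (F : nat -> {set V})
    (Hproc : frontier_process E w s d F) :
  (~ reachable_negative_cycle E w s ->
     forall v : V, d (#|V| - 1)%N v = distance E w s v) /\
  ((exists (v : V) (t : nat), (#|V| <= t)%N /\ d t v < d (#|V| - 1)%N v) ->
     reachable_negative_cycle E w s).
Proof.
have settled : ~ reachable_negative_cycle E w s ->
    forall v, d (#|V| - 1)%N v = distance E w s v.
  move=> no_negative_cycle v; apply: (process_eq_distance Hproc) => //.
  by rewrite subn1 leqSpred.
split=> // -[v [t [_ d_lt]]]; apply: contrapT => /settled def_d.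
by move: d_lt; rewrite def_d ltNge (distance_le_process Hproc).
Qed.
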